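(* Let $P$ be a probability distribution of $(Y,\mathbf X)\in\mathbb{R}^m\times\mathbb{R}^p$ and let $B\in\mathbb{R}^{p\times m}$. Then $$\mathcal{D}_{MR}^{E}(B,P)=D_{MR}(B,P).$$
   Context: The residual smallness depth is $\mathcal{D}_{MR}^{E}(B,P)=\inf_{U\in\mathbb{R}^{p\times m}}P\left(\|Y-B^t\mathbf X\|\le\|Y-U^t\mathbf X\|\right)$. The multivariate regression depth is $D_{MR}(B,P)=\inf_{U\in\mathbb{R}^{p\times m}\setminus\{0\}}P\left(\langle U^t\mathbf X,\,Y-B^t\mathbf X\rangle\ge0\right)$. Here $\langle\cdot,\cdot\rangle$ and $\|\cdot\|$ are the Euclidean inner product and norm in $\mathbb{R}^m$. *)

(* Defs.v *)
From HB Require Import structures.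
From mathcomp Require Import all_boot all_order all_algebra.
From mathcomp Require Import all_classical all_reals all_analysis.

Set Implicit Arguments.
Unset Strict Implicit.
Unset Printing Implicit Defensive.

Import Order.TTheory GRing.Theory Num.Theory.
Import numFieldNormedType.Exports.

Local Open Scope classical_set_scope.
Local Open Scope ring_scope.

(* The library norm `|u| on matrices is the sup norm, hence the definitions of
   the Euclidean inner product and norm. *)
Definition dotv (R : realType) (m : nat) (u v : 'cV[R]_m) : R :=
  \sum_(i < m) u i 0 * v i 0.

Definition enorm (R : realType) (m : nat) (u : 'cV[R]_m) : R :=
  Num.sqrt (dotv u u).

(* R^m * R^p with its Borel sigma-algebra; a point is a pair z = (y, x). *)
Notation obs_space R m p :=
  (g_sigma_algebraType (@open ('cV[R]_m * 'cV[R]_p)%type)).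

(* The infima are taken in \bar R; that of regression_depth is over the empty
   set, hence +oo, when m = 0 or p = 0. *)
Definition residual_smallness_depth (R : realType) (m p : nat)
    (B : 'M[R]_(p, m)) (P : probability (obs_space R m p) R) : \bar R :=
  ereal_inf [set P [set z : 'cV[R]_m * 'cV[R]_p |
                    enorm (z.1 - B^T *m z.2) <= enorm (z.1 - U^T *m z.2)]
            | U in [set: 'M[R]_(p, m)]].

Definition regression_depth (R : realType) (m p : nat)
    (B : 'M[R]_(p, m)) (P : probability (obs_space R m p) R) : \bar R :=
  ereal_inf [set P [set z : 'cV[R]_m * 'cV[R]_p |
                    0 <= dotv (U^T *m z.2) (z.1 - B^T *m z.2)]
            | U in [set U : 'M[R]_(p, m) | U != 0]].

(* Main.v *)
Require Import Defs.
From mathcomp Require Import all_boot all_order all_algebra.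
From mathcomp Require Import ring lra.
From mathcomp Require Import all_classical all_reals all_analysis.
Import Order.TTheory GRing.Theory Num.Theory.
Import numFieldNormedType.Exports.

(** Write r = y - B^T x for the residual of B at an observation (y, x), and for
    a direction W put w = W^T x, the value that W fits there.  Replacing B by
    the competitor U = B - 2e W, with e > 0, changes the residual into
    r + 2e w, and
      |r + 2e w|^2 = |r|^2 + 4e (<w, r> + e |w|^2),
    so B fits at least as well as U exactly on the event
      T_e = { <w, r> + e |w|^2 >= 0 }        (tilted_halfspace below).
    The events of the residual smallness depth are thus the T_e with e > 0,
    together with the sure event U = B, whereas those of the regression depth
    are the T_0 with W != 0.

    Since |w|^2 >= 0, the events T_e increase with e.  Hence P T_e >= P T_0 for
    every competitor U != B, and the regression depth is at most the residual
    smallness depth.  For U = B the bound holds because some W != 0 exists and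
    gives a T_0 of probability at most 1.

    Conversely the intersection of the T_{1/(n+1)} is T_0, so that
    P T_{1/(n+1)} tends to P T_0 by continuity from above: competitors
    approaching B along the ray of direction -W bring the residual smallness
    depth down to P T_0.  Continuity from above needs the T_e to be Borel sets;
    they are closed, being superlevel sets of functions continuous in (y, x). *)

Set Implicit Arguments.
Unset Strict Implicit.
Unset Printing Implicit Defensive.

Local Open Scope classical_set_scope.
Local Open Scope ring_scope.

Lemma dotv_ge0 (R : realType) (m : nat) (u : 'cV[R]_m) : 0 <= dotv u u.
Proof. by apply: sumr_ge0 => i _; rewrite -expr2 sqr_ge0. Qed.

Lemma dotv_addl_scale (R : realType) (m : nat) (e : R) (r w : 'cV[R]_m) :
  dotv (r + (2 * e) *: w) (r + (2 * e) *: w)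
    = dotv r r + 4 * e * (dotv w r + e * dotv w w).
Proof.
rewrite /dotv !mulr_sumr -!big_split /= mulr_sumr -big_split /=.
by apply: eq_bigr => i _; rewrite !mxE; ring.
Qed.

Lemma enorm_le_addl_scale (R : realType) (m : nat) (e : R) (r w : 'cV[R]_m) :
  0 < e ->
  (enorm r <= enorm (r + (2 * e) *: w)) = (0 <= dotv w r + e * dotv w w).
Proof.
move=> e0; rewrite /enorm ler_psqrt ?nnegrE ?dotv_ge0 //.
by rewrite dotv_addl_scale lerDl pmulr_rge0 // mulr_gt0.
Qed.

Lemma ge0_of_harmonic_perturbation (R : realType) (a b : R) :
  (forall n : nat, 0 <= a + n.+1%:R^-1 * b) -> 0 <= a.
Proof.
move=> h; rewrite leNgt; apply/negP => a0.
(* A perturbation b / (n + 1) smaller than - a leaves the sum negative. *)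
have [n bn] : exists n : nat, b / - a < n.+1%:R.
  by exists (Num.truncn (b / - a)); exact: Num.Theory.truncnS_gt.
have n0 : (0 : R) < n.+1%:R by rewrite ltr0n.
move: (h n) bn; rewrite ltr_pdivrMr ?oppr_gt0 // => hn bn.
have : 0 <= n.+1%:R * a + b.
  have -> : n.+1%:R * a + b = n.+1%:R * (a + n.+1%:R^-1 * b).
    by rewrite mulrDr mulrA divff ?gt_eqF // mul1r.
  by rewrite mulr_ge0 // ltW.
lra.
Qed.

Lemma continuous_dotv (R : realType) (T : topologicalType) (m : nat)
    (u v : T -> 'cV[R]_m) :
  (forall i, continuous (fun z => u z i 0)) ->
  (forall i, continuous (fun z => v z i 0)) ->
  continuous (fun z => dotv (u z) (v z)).
Proof.
move=> uc vc; apply: continuous_big => [|i _ z]; first exact: add_continuous.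
by apply: continuousM; [exact: uc | exact: vc].
Qed.

Lemma continuous_mulmx_snd (R : realType) (m p : nat) (A : 'M[R]_(m, p)) (i : 'I_m) :
  continuous (fun z : 'cV[R]_m * 'cV[R]_p => (A *m z.2) i 0).
Proof.
under eq_fun do rewrite mxE.
apply: continuous_big => [|k _ z]; first exact: add_continuous.
apply: continuousM; first exact: cst_continuous.
apply: (@continuous_comp _ _ _ snd (fun x : 'cV[R]_p => x k 0)).
  exact: cvg_snd.
exact: coord_continuous.
Qed.

Lemma continuous_residual (R : realType) (m p : nat) (B : 'M[R]_(p, m))
    (i : 'I_m) :
  continuous (fun z : 'cV[R]_m * 'cV[R]_p => (z.1 - B^T *m z.2) i 0).
Proof.
under eq_fun do rewrite mxE [X in _ + X]mxE.
move=> z; apply: continuousB; last exact: continuous_mulmx_snd.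
apply: (@continuous_comp _ _ _ fst (fun x : 'cV[R]_m => x i 0)).
  exact: cvg_fst.
exact: coord_continuous.
Qed.

(** For e = 0 this is the event that the regression depth attaches to W; for
    e > 0 it is the one that the residual smallness depth attaches to the
    competitor B - 2e W, see tilted_halfspace_competitor.  One family thus
    carries both depths. *)
Definition tilted_halfspace (R : realType) (m p : nat) (B W : 'M[R]_(p, m))
    (e : R) : set ('cV[R]_m * 'cV[R]_p) :=
  [set z | 0 <= dotv (W^T *m z.2) (z.1 - B^T *m z.2)
                + e * dotv (W^T *m z.2) (W^T *m z.2)].

Lemma tilted_halfspace_competitor (R : realType) (m p : nat)
    (B W : 'M[R]_(p, m)) (e : R) : 0 < e ->
  [set z : 'cV[R]_m * 'cV[R]_p |
     enorm (z.1 - B^T *m z.2)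
     <= enorm (z.1 - (B - (2 * e) *: W)^T *m z.2)]
  = tilted_halfspace B W e.
Proof.
move=> e0; apply/funext => z; rewrite /tilted_halfspace /=.
rewrite -enorm_le_addl_scale //; congr (is_true (_ <= enorm _)).
by rewrite linearB linearZ /= mulmxBl -scalemxAl opprB addrCA addrC.
Qed.

Lemma tilted_halfspace0 (R : realType) (m p : nat) (B W : 'M[R]_(p, m)) :
  tilted_halfspace B W 0
  = [set z | 0 <= dotv (W^T *m z.2) (z.1 - B^T *m z.2)].
Proof.
by apply/funext => z; rewrite /tilted_halfspace /= mul0r addr0.
Qed.

Lemma subset_tilted_halfspace (R : realType) (m p : nat) (B W : 'M[R]_(p, m))
    (e e' : R) :
  e <= e' -> tilted_halfspace B W e `<=` tilted_halfspace B W e'.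
Proof.
move=> ee' z /= /le_trans; apply.
by rewrite lerD2l ler_wpM2r // dotv_ge0.
Qed.

Lemma bigcap_tilted_halfspace (R : realType) (m p : nat) (B W : 'M[R]_(p, m)) :
  \bigcap_n tilted_halfspace B W n.+1%:R^-1 = tilted_halfspace B W 0.
Proof.
apply/seteqP; split => z; last first.
  by move=> Tz n _; apply: subset_tilted_halfspace Tz; rewrite invr_ge0.
rewrite tilted_halfspace0 => Tz.
by apply: ge0_of_harmonic_perturbation => n; exact: Tz.
Qed.

Lemma measurable_tilted_halfspace (R : realType) (m p : nat)
    (B W : 'M[R]_(p, m)) (e : R) :
  measurable (tilted_halfspace B W e : set (obs_space R m p)).
Proof.
(* The open sets are the generators, so the complement is the one to treat. *)
rewrite -[X in measurable X]setCK; apply: measurableC.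
apply: sub_sigma_algebra; rewrite openC.
set f := fun z : 'cV[R]_m * 'cV[R]_p =>
  dotv (W^T *m z.2) (z.1 - B^T *m z.2)
  + e * dotv (W^T *m z.2) (W^T *m z.2).
have wc := @continuous_mulmx_snd R m p W^T.
have rc := @continuous_residual R m p B.
have fc : continuous f.
  move=> z; apply: (cvgD (@continuous_dotv _ _ _ _ _ wc rc z)).
  by apply: cvgM; [exact: cvg_cst | exact: (@continuous_dotv _ _ _ _ _ wc wc z)].
apply: (@preimage_closed _ _ f [set x | 0 <= x]) => [z _|]; first exact: fc.
exact: closed_ge.
Qed.

(** Continuity from above: this is what turns the competitors U != B, which
    only give e > 0, into the event e = 0 of the regression depth. *)
Lemma cvg_probability_tilted_halfspace (R : realType) (m p : nat)
    (P : probability (obs_space R m p) R) (B W : 'M[R]_(p, m)) :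
  P (tilted_halfspace B W n.+1%:R^-1) @[n --> \oo]
    --> P (tilted_halfspace B W 0).
Proof.
rewrite -bigcap_tilted_halfspace.
apply: (@nonincreasing_cvg_mu _ _ _ P
  (fun n => tilted_halfspace B W n.+1%:R^-1)).
- apply: le_lt_trans (ltry 1).
  by apply: probability_le1; exact: measurable_tilted_halfspace.
- by move=> n; exact: measurable_tilted_halfspace.
- by rewrite bigcap_tilted_halfspace; exact: measurable_tilted_halfspace.
- move=> k n kn; apply/subsetPset/subset_tilted_halfspace.
  by rewrite lef_pV2 ?posrE ?ltr0n // ler_nat.
Qed.

(** The infimum over all competitors is below the limit along each ray
    B - (2 / (n + 1)) W. *)
Lemma le_residual_smallness_depth (R : realType) (m p : nat)
    (P : probability (obs_space R m p) R) (B : 'M[R]_(p, m)) :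
  (residual_smallness_depth B P <= regression_depth B P)%E.
Proof.
apply: le_ereal_inf_tmp => _ [W _ <-]; rewrite -tilted_halfspace0.
have cvgP := @cvg_probability_tilted_halfspace R m p P B W.
rewrite -(cvg_lim _ cvgP) //; apply: lime_ge.
  by apply/cvg_ex; eexists; exact: cvgP.
apply: nearW => n; apply: ereal_inf_lbound.
exists (B - (2 * n.+1%:R^-1) *: W) => //.
by rewrite tilted_halfspace_competitor // invr_gt0.
Qed.

(** Tilting by e > 0 only enlarges the event of the regression depth.  The
    competitor U = B is not a tilt of any nonzero direction; its event is sure,
    and a nonzero matrix keeps the infimum on the left from being +oo. *)
Lemma ge_residual_smallness_depth (R : realType) (m p : nat)
    (m_gt0 : (0 < m)%N) (p_gt0 : (0 < p)%N)
    (P : probability (obs_space R m p) R) (B : 'M[R]_(p, m)) :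
  (regression_depth B P <= residual_smallness_depth B P)%E.
Proof.
apply: le_ereal_inf_tmp => _ [U _ <-].
have half : (2 * 2^-1 : R) = 1 by rewrite divff // pnatr_eq0.
have [->|UB] := eqVneq U B.
  have -> : [set z : 'cV[R]_m * 'cV[R]_p |
      enorm (z.1 - B^T *m z.2) <= enorm (z.1 - B^T *m z.2)] = setT.
    by apply/seteqP; split => z //= _; exact: lexx.
  rewrite probability_setT.
  pose W : 'M[R]_(p, m) := delta_mx (Ordinal p_gt0) (Ordinal m_gt0).
  have W0 : W != 0.
    apply/eqP => /matrixP/(_ (Ordinal p_gt0) (Ordinal m_gt0)).
    by rewrite !mxE !eqxx; apply/eqP; rewrite oner_eq0.
  apply: (@le_trans _ _ (P (tilted_halfspace B W 0))).
    by apply: ereal_inf_lbound; exists W => //; rewrite tilted_halfspace0.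
  by apply: probability_le1; exact: measurable_tilted_halfspace.
(* Any e > 0 would do to write U as a competitor along a ray; e = 1/2 lets the
   direction be B - U itself. *)
have -> : U = B - (2 * 2^-1) *: (B - U).
  by rewrite half scale1r opprB addrC subrK.
rewrite tilted_halfspace_competitor ?invr_gt0 //.
apply: (@le_trans _ _ (P (tilted_halfspace B (B - U) 0))).
  apply: ereal_inf_lbound; exists (B - U); last by rewrite tilted_halfspace0.
  by rewrite /= subr_eq0 eq_sym.
apply: le_measure; rewrite ?inE; try exact: measurable_tilted_halfspace.
by apply: subset_tilted_halfspace; rewrite invr_ge0.
Qed.

Theorem lemma11 (R : realType) (m p : nat) (m_gt0 : (0 < m)%N) (p_gt0 : (0 < p)%N)
    (P : probability (obs_space R m p) R) (B : 'M[R]_(p, m)) :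
  residual_smallness_depth B P = regression_depth B P.
Proof.
apply/le_anti/andP; split; first exact: le_residual_smallness_depth.
exact: ge_residual_smallness_depth.
Qed.
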